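(* Let $(G,H,\alpha,\tau)$ be a Lie crossed module, and let $\overline A$ and $A$ be connection forms on a principal $G$-bundle $\pi:P\to M$. Let $B$ be an $L(H)$-valued $\alpha$-equivariant $2$-form on $P$ vanishing on vertical vectors, and for a continuous vector field $\tilde v$ along an $\overline A$-horizontal piecewise $C^1$ path $\tilde\gamma:[t_0,t_1]\to P$ let $$\omega_{(A,B)}(\tilde v)=A\bigl(\tilde v(t_0)\bigr)+\tau\left[\int_{t_0}^{t_1}B\bigl(\tilde\gamma'(t),\tilde v(t)\bigr)\,dt\right].$$ Then $$\omega_{(A,B)}(\tilde v g)=\mathrm{Ad}(g^{-1})\,\omega_{(A,B)}(\tilde v)$$ for all $g\in G$ and all continuous vector fields $\tilde v$ along any $\overline A$-horizontal piecewise $C^1$ path $\tilde\gamma:[t_0,t_1]\to P$. Moreover, if $Y$ is any element of the Lie algebra $L(G)$ and $\tilde Y$ is the vector field along $\tilde\gamma$ given by $\tilde Y(t)=\frac{d}{du}\big|_{u=0}\tilde\gamma(t)\exp(uY)$, then $$\omega_{(A,B)}(\tilde Y)=Y.$$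
   Context: A crossed module $(G,H,\alpha,\tau)$ consists of groups $G,H$ and homomorphisms $\tau:H\to G$, $\alpha:G\to\mathrm{Aut}(H)$ with $\tau(\alpha(g)h)=g\tau(h)g^{-1}$ and $\alpha(\tau(h))(h')=hh'h^{-1}$ for all $g\in G$, $h,h'\in H$. It is a Lie crossed module if $G,H$ are Lie groups, $\tau$ is smooth, and $(g,h)\mapsto\alpha(g)h$ is smooth. $L(\cdot)$ denotes the Lie algebra; the derivatives $L(H)\to L(G)$ of $\tau$ and $L(H)\to L(H)$ of $\alpha(g)$ are again denoted $\tau$ and $\alpha(g)$. For $v\in T_pP$ and $g\in G$, $vg=dR_g|_p(v)\in T_{pg}P$, where $R_g(p)=pg$ is the right action; $\tilde vg$ is the vector field $t\mapsto\tilde v(t)g$ along the path $\tilde\gamma g:t\mapsto\tilde\gamma(t)g$. The $2$-form $B$ is $\alpha$-equivariant if $B_{pg}(vg,wg)=\alpha(g^{-1})B_p(v,w)$ for all $g\in G$, $p\in P$, $v,w\in T_pP$; it vanishes on vertical vectors if $B(v,w)=0$ whenever $v,w\in T_pP$ and $\pi_*v=0$. A piecewise $C^1$ path $\tilde\gamma$ in $P$ is $\overline A$-horizontal if $\overline A(\tilde\gamma'(t))=0$ wherever $\tilde\gamma'(t)$ exists. A vector field along $\tilde\gamma$ is a map $\tilde v$ with $\tilde v(t)\in T_{\tilde\gamma(t)}P$. A connection form $A$ satisfies $A(vg)=\mathrm{Ad}(g^{-1})A(v)$ and $A\bigl(\frac{d}{du}|_{u=0}\,p\exp(uY)\bigr)=Y$.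 *)

(* Defs.v *)
From HB Require Import structures.
From mathcomp Require Import all_boot all_order all_algebra.
From mathcomp Require Import all_classical all_reals all_analysis.
Import Order.TTheory GRing.Theory Num.Theory.
Import numFieldNormedType.Exports.

Set Implicit Arguments.
Unset Strict Implicit.
Unset Printing Implicit Defensive.

Local Open Scope classical_set_scope.
Local Open Scope ring_scope.

(* [Ck_on k U f] is meant for an open set U of a finite-dimensional space E;
   there it says that f is of class C^k on U: the derivatives of f in all fixed
   directions v are of class C^(k-1). *)
Fixpoint Ck_on (R : realType) (E F : normedModType R) (k : nat) (U : set E)
    (f : E -> F) : Prop :=
  match k with
  | 0%N => forall x, U x -> {for x, continuous f}
  | k'.+1 => (forall x, U x -> differentiable f x) /\
             (forall v : E, Ck_on k' U (fun x => 'd f x v))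
  end.

Definition smooth_on (R : realType) (E F : normedModType R) (U : set E)
    (f : E -> F) : Prop :=
  forall k, Ck_on k U f.

(* A homeomorphism from the open set [dom] of T onto the open set [cod] of R^n;
   the values of [fwd] off [dom] and of [bwd] off [cod] are irrelevant. *)
Record chart (R : realType) (n : nat) (T : topologicalType) := Chart {
  dom : set T;
  cod : set 'rV[R]_n;
  fwd : T -> 'rV[R]_n;
  bwd : 'rV[R]_n -> T;
  open_dom : open dom;
  open_cod : open cod;
  fwd_cod : forall p, dom p -> cod (fwd p);
  bwd_dom : forall x, cod x -> dom (bwd x);
  fwdK : forall p, dom p -> bwd (fwd p) = p;
  bwdK : forall x, cod x -> fwd (bwd x) = x;
  fwd_continuous : forall p, dom p -> {for p, continuous fwd};
  bwd_continuous : forall x, cod x -> {for x, continuous bwd}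
}.

(* A smooth manifold of dimension n. The atlas need not be maximal. The chart
   [chart_at p] around p serves only to represent tangent vectors, see
   [tangent] below. *)
HB.mixin Record isManifold (R : realType) (n : nat) M of Topological M := {
  atlas : set (chart R n M);
  chart_at : M -> chart R n M;
  chart_at_atlas : forall p, atlas (chart_at p);
  chart_at_dom : forall p, dom (chart_at p) p;
  atlas_smooth : forall c d, atlas c -> atlas d ->
    smooth_on (cod c `&` bwd c @^-1` dom d) (fwd d \o bwd c);
  manifold_hausdorff : hausdorff_space M;
  manifold_second_countable : @second_countable M
}.

#[short(type="manifoldType")]
HB.structure Definition Manifold (R : realType) (n : nat) :=
  { M of isManifold R n M & Topological M }.

(* Smoothness of a map into a manifold, on an open subset U of a
   finite-dimensional space. *)
Definition smooth_from (R : realType) (E : normedModType R) (n : nat)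
    (N : manifoldType R n) (U : set E) (f : E -> N) : Prop :=
  (forall x, U x -> {for x, continuous f}) /\
  (forall d : chart R n N, atlas d ->
     smooth_on (U `&` f @^-1` dom d) (fwd d \o f)).

Definition smooth_map_on (R : realType) (m n : nat) (M : manifoldType R m)
    (N : manifoldType R n) (U : set M) (f : M -> N) : Prop :=
  forall c : chart R m M, atlas c ->
    smooth_from (cod c `&` bwd c @^-1` U) (f \o bwd c).

(* Smoothness of a map on the open subset U x V of the product manifold M x N,
   whose atlas consists of the products of charts of M and N. *)
Definition smooth_map2_on (R : realType) (m n q : nat) (M : manifoldType R m)
    (N : manifoldType R n) (Q : manifoldType R q) (U : set M) (V : set N)
    (f : M -> N -> Q) : Prop :=
  forall (c : chart R m M) (d : chart R n N), atlas c -> atlas d ->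
    smooth_from ((cod c `&` bwd c @^-1` U) `*` (cod d `&` bwd d @^-1` V))
      (fun z : 'rV[R]_m * 'rV[R]_n => f (bwd c z.1) (bwd d z.2)).

(* The tangent space T_pM, a tangent vector being represented by its
   coordinates in the chart [chart_at p]. Types [tangent p] for different p are
   convertible, but the meaning of the coordinates depends on p. *)
Definition tangent (R : realType) (n : nat) (M : manifoldType R n) (p : M) :
  Type := 'rV[R]_n.

(* The coordinates, in the chart c, of v in T_pM. *)
Definition coord_in (R : realType) (n : nat) (M : manifoldType R n)
    (c : chart R n M) (p : M) (v : tangent p) : 'rV[R]_n :=
  'd (fwd c \o bwd (chart_at p)) (fwd (chart_at p) p) v.
Arguments coord_in {R n M} c p v.

(* Conversely, the tangent vector at [bwd c x] with coordinates u in c. *)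
Definition of_coord (R : realType) (n : nat) (M : manifoldType R n)
    (c : chart R n M) (x u : 'rV[R]_n) : tangent (bwd c x) :=
  'd (fwd (chart_at (bwd c x)) \o bwd c) x u.

(* The differential of f at p. *)
Definition tdiff (R : realType) (m n : nat) (M : manifoldType R m)
    (N : manifoldType R n) (f : M -> N) (p : M) (v : tangent p) :
    tangent (f p) :=
  'd (fwd (chart_at (f p)) \o f \o bwd (chart_at p)) (fwd (chart_at p) p) v.
Arguments tdiff {R m n M N} f p v.

(* v is the derivative at t of the curve c restricted to D (so a one-sided
   derivative when D is a segment with endpoint t). *)
Definition has_velocity (R : realType) (n : nat) (M : manifoldType R n)
    (D : set R) (c : R -> M) (t : R) (v : tangent (c t)) : Prop :=
  c @ within D (nbhs t) --> c t /\
  (fun s : R => (s - t)^-1 *: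
     (fwd (chart_at (c t)) (c s) - fwd (chart_at (c t)) (c t)))
    @ within (D `\ t) (nbhs t) --> (v : 'rV[R]_n).
Arguments has_velocity {R n M} D c t v.

(* The derivative of c|D at t, with value 0 where it does not exist. *)
Definition velocity (R : realType) (n : nat) (M : manifoldType R n)
    (D : set R) (c : R -> M) (t : R) : tangent (c t) :=
  xget (0 : 'rV[R]_n) [set v | has_velocity D c t v].

(* Continuity on D of a vector field v along c, as a map into the tangent
   bundle. *)
Definition continuous_field (R : realType) (n : nat) (M : manifoldType R n)
    (D : set R) (c : R -> M) (v : forall t, tangent (c t)) : Prop :=
  forall t, D t ->
    (fun s => coord_in (chart_at (c t)) (c s) (v s)) @ within D (nbhs t)
      --> coord_in (chart_at (c t)) (c t) (v t).
Arguments continuous_field {R n M} D c v.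

Definition C1_on (R : realType) (n : nat) (M : manifoldType R n)
    (D : set R) (c : R -> M) : Prop :=
  exists w : forall t, tangent (c t),
    (forall t, D t -> has_velocity D c t (w t)) /\ continuous_field D c w.

Definition piecewise_C1 (R : realType) (n : nat) (M : manifoldType R n)
    (t0 t1 : R) (c : R -> M) : Prop :=
  {within `[t0, t1], continuous c} /\
  exists s : seq R, [/\ path <%R t0 s, last t0 s = t1 &
    forall i, (i < size s)%N ->
      C1_on `[nth t0 (t0 :: s) i, nth t0 s i] c].

HB.mixin Record isLieGroup (R : realType) (n : nat) G
    of Manifold R n G & Group G := {
  mulg_smooth : smooth_map2_on (R := R) [set: G] [set: G]
    (fun x y : G => (x * y)%g);
  invg_smooth : smooth_map_on (R := R) [set: G] (fun x : G => (x^-1)%g)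
}.

#[short(type="lieGroupType")]
HB.structure Definition LieGroup (R : realType) (n : nat) :=
  { G of isLieGroup R n G & Manifold R n G & Group G }.

(* Only the underlying vector space of the Lie algebra L(G) is needed. *)
Definition lie_alg (R : realType) (n : nat) (G : lieGroupType R n) : Type :=
  tangent (1%g : G).

(* The differential L(G) -> L(K) of a map f with f 1 = 1. *)
Definition lie_diff (R : realType) (m n : nat) (G : lieGroupType R m)
    (K : lieGroupType R n) (f : G -> K) : lie_alg G -> lie_alg K :=
  fun v => tdiff f (1%g : G) v.

Definition Ad (R : realType) (n : nat) (G : lieGroupType R n) (g : G) :
    lie_alg G -> lie_alg G :=
  lie_diff (fun h : G => (g * h * g^-1)%g).

Definition one_parameter_subgroup (R : realType) (n : nat)
    (G : lieGroupType R n) (Y : lie_alg G) (c : R -> G) : Prop :=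
  [/\ forall s t, c (s + t) = (c s * c t)%g,
      smooth_from setT (c : R^o -> G)
    & has_velocity setT c 0 Y].

(* The value at 1 of the (unique) one-parameter subgroup with initial
   velocity Y. *)
Definition lie_exp (R : realType) (n : nat) (G : lieGroupType R n)
    (Y : lie_alg G) : G :=
  xget 1%g [set g | exists2 c, one_parameter_subgroup Y c & c 1 = g].

Record lie_crossed_module (R : realType) (m n : nat) (G : lieGroupType R m)
    (H : lieGroupType R n) (alpha : G -> H -> H) (tau : H -> G) : Prop := {
  tauM : {morph tau : h k / (h * k)%g};
  alpha_aut : forall g, bijective (alpha g) /\
                        {morph alpha g : h k / (h * k)%g};
  alphaM : forall g g' h, alpha (g * g')%g h = alpha g (alpha g' h);
  tau_alpha : forall g h, tau (alpha g h) = (g * tau h * g^-1)%g;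
  peiffer : forall h h', alpha (tau h) h' = (h * h' * h^-1)%g;
  tau_smooth : smooth_map_on [set: H] tau;
  alpha_smooth : smooth_map2_on [set: G] [set: H] alpha
}.

(* In [local_triviality], p |-> (proj p, phi p) is a G-equivariant diffeomorphism
   from proj^-1(U) onto U x G, with inverse psi. *)
Record principal_bundle (R : realType) (nG nP nM : nat)
    (G : lieGroupType R nG) (P : manifoldType R nP) (M : manifoldType R nM)
    (proj : P -> M) (act : P -> G -> P) : Prop := {
  act1 : forall p, act p 1%g = p;
  actM : forall p g h, act p (g * h)%g = act (act p g) h;
  act_smooth : smooth_map2_on [set: P] [set: G] act;
  proj_smooth : smooth_map_on [set: P] proj;
  proj_act : forall p g, proj (act p g) = proj p;
  local_triviality : forall x : M, exists U : set M, [/\ open U, U x &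
    exists (phi : P -> G) (psi : M -> G -> P),
    [/\ smooth_map_on (proj @^-1` U) phi,
        smooth_map2_on U [set: G] psi,
        forall p g, U (proj p) -> phi (act p g) = (phi p * g)%g,
        forall y g, U y -> proj (psi y g) = y /\ phi (psi y g) = g
      & forall p, U (proj p) -> psi (proj p) (phi p) = p]]
}.

(* vg = dR_g(v) *)
Definition act_tangent (R : realType) (nG nP : nat) (G : lieGroupType R nG)
    (P : manifoldType R nP) (act : P -> G -> P) (p : P) (v : tangent p)
    (g : G) : tangent (act p g) :=
  tdiff (fun q => act q g) p v.
Arguments act_tangent {R nG nP G P} act p v g.

(* d/du|_{u=0} p exp(uY), a vector at p exp(0) = p *)
Definition fundamental (R : realType) (nG nP : nat) (G : lieGroupType R nG)
    (P : manifoldType R nP) (act : P -> G -> P) (Y : lie_alg G) (p : P) :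
    tangent p :=
  velocity setT
    (fun u : R => act p (lie_exp (u *: (Y : 'rV[R]_nG) : lie_alg G))) 0.

Record connection_form (R : realType) (nG nP : nat) (G : lieGroupType R nG)
    (P : manifoldType R nP) (act : P -> G -> P)
    (A : forall p : P, tangent p -> lie_alg G) : Prop := {
  connection_linear : forall p : P,
    linear (A p : 'rV[R]_nP -> 'rV[R]_nG);
  connection_smooth : forall (c : chart R nP P) (u : 'rV[R]_nP), atlas c ->
    smooth_on (cod c) (fun x => A (bwd c x) (of_coord c x u) : 'rV[R]_nG);
  connection_equivariant : forall (p : P) (v : tangent p) (g : G),
    A (act p g) (act_tangent act p v g) = Ad (g^-1)%g (A p v);
  connection_fundamental : forall (p : P) (Y : lie_alg G),
    A p (fundamental act Y p) = Y
}.

(* A smooth L(H)-valued 2-form on P. *)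
Record two_form (R : realType) (nH nP : nat) (H : lieGroupType R nH)
    (P : manifoldType R nP)
    (B : forall p : P, tangent p -> tangent p -> lie_alg H) : Prop := {
  two_form_linear_l : forall (p : P) (w : tangent p),
    linear (B p ^~ w : 'rV[R]_nP -> 'rV[R]_nH);
  two_form_linear_r : forall (p : P) (v : tangent p),
    linear (B p v : 'rV[R]_nP -> 'rV[R]_nH);
  two_form_alternating : forall (p : P) (v : tangent p),
    B p v v = (0 : 'rV[R]_nH);
  two_form_smooth : forall (c : chart R nP P) (u w : 'rV[R]_nP), atlas c ->
    smooth_on (cod c)
      (fun x => B (bwd c x) (of_coord c x u) (of_coord c x w) : 'rV[R]_nH)
}.

Definition alpha_equivariant (R : realType) (nG nH nP : nat)
    (G : lieGroupType R nG) (H : lieGroupType R nH) (P : manifoldType R nP)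
    (act : P -> G -> P) (alpha : G -> H -> H)
    (B : forall p : P, tangent p -> tangent p -> lie_alg H) : Prop :=
  forall (g : G) (p : P) (v w : tangent p),
    B (act p g) (act_tangent act p v g) (act_tangent act p w g)
      = lie_diff (alpha (g^-1)%g) (B p v w).

Definition vanishes_on_vertical (R : realType) (nH nP nM : nat)
    (H : lieGroupType R nH) (P : manifoldType R nP) (M : manifoldType R nM)
    (proj : P -> M)
    (B : forall p : P, tangent p -> tangent p -> lie_alg H) : Prop :=
  forall (p : P) (v w : tangent p),
    tdiff proj p v = (0 : 'rV[R]_nM) -> B p v w = (0 : 'rV[R]_nH).

Definition horizontal (R : realType) (nG nP : nat) (G : lieGroupType R nG)
    (P : manifoldType R nP) (A : forall p : P, tangent p -> lie_alg G)
    (t0 t1 : R) (c : R -> P) : Prop :=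
  forall (t : R) (v : tangent (c t)), t \in `[t0, t1] ->
    has_velocity `[t0, t1] c t v -> A (c t) v = (0 : 'rV[R]_nG).

(* The integral of an L(H)-valued function, computed in the coordinates of
   L(H) = R^n. *)
Definition lie_integral (R : realType) (n : nat) (H : lieGroupType R n)
    (t0 t1 : R) (f : R -> lie_alg H) : lie_alg H :=
  \row_(j < n)
    \int[lebesgue_measure]_(t in `[t0, t1]) (f t : 'rV[R]_n) 0 j.

Definition omega (R : realType) (nG nH nP : nat) (G : lieGroupType R nG)
    (H : lieGroupType R nH) (P : manifoldType R nP) (tau : H -> G)
    (A : forall p : P, tangent p -> lie_alg G)
    (B : forall p : P, tangent p -> tangent p -> lie_alg H)
    (t0 t1 : R) (c : R -> P) (v : forall t, tangent (c t)) : lie_alg G :=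
  (A (c t0) (v t0) : 'rV[R]_nG) +
  lie_diff tau (lie_integral t0 t1
    (fun t => B (c t) (velocity `[t0, t1] c t) (v t))).
Arguments omega {R nG nH nP G H P} tau A B t0 t1 c v.

(* Main.v *)
(* Right translation R_g is a diffeomorphism of P with inverse R_{g^-1}, so it
   maps velocities of gamma to velocities of gamma g, also at the points where
   neither exists and both are 0 by convention. Equivariance of A and B then
   turns omega(v g) into Ad(g^-1) A(v(t0)) + tau (int alpha(g^-1) B(gamma', v)).
   The integrand is piecewise continuous, hence integrable, so the linear map
   alpha(g^-1) leaves the integral, and tau alpha(g^-1) = Ad(g^-1) tau is the
   differential of the first axiom of crossed modules.
   For the second part, p exp(uY) stays in the fibre of p, so its velocity at 0
   is vertical and the integrand vanishes. That this velocity is a vector at p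
   requires exp(0) = 1, where [lie_exp] picks the value of some one-parameter
   subgroup with velocity 0 at 0; such a subgroup is constant by the mean value
   theorem. *)
Require Import Defs.
From HB Require Import structures.
From mathcomp Require Import all_boot all_order all_algebra.
From mathcomp Require Import all_classical all_reals all_analysis.
From mathcomp Require Import measurable_realfun.
From mathcomp Require Import lra.
Import Order.TTheory GRing.Theory Num.Theory.
Import numFieldNormedType.Exports.

Set Implicit Arguments.
Unset Strict Implicit.
Unset Printing Implicit Defensive.

Local Open Scope classical_set_scope.
Local Open Scope ring_scope.

(** * Differentials in normed spaces *)

Lemma near_cvg (T U : Type) (F : set_system T) (FF : Filter F)
    (G : set_system U) (f g : T -> U) :
  (\forall s \near F, f s = g s) -> f @ F --> G -> g @ F --> G.
Proof.
move=> fg fG A /fG; rewrite /fmap /nbhs /=; apply: filterS2 fg.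
by move=> s /= ->.
Qed.

(** The first-order expansion of [f] at [x] is also one of [g], and expansions are unique.
    Identities between charts hold only near a point, so differentials must be compared through
    germs. *)
Lemma near_eq_diff (R : realType) (E F : normedModType R) (f g : E -> F)
    (x : E) :
  {near x, f =1 g} -> differentiable f x ->
  differentiable g x /\ 'd g x = 'd f x :> (E -> F).
Proof.
move=> fg df.
have [dfc /eqaddoP fo] := (diff_locallyP _ _).1 df.
have go : g \o shift x = cst (g x) + 'd f x +o_ 0 id.
  apply/eqaddoP => e e0; near=> h.
  have <- : (f \o shift x - (cst (f x) + 'd f x)) h
          = (g \o shift x - (cst (g x) + 'd f x)) h.
    have fgx : f x = g x by exact: nbhs_singleton fg.
    have fgh : f (h + x) = g (h + x).
      near: h; have : \forall y \near x, f y = g y by [].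
      rewrite (near_shift 0 x) /=; apply: filterS => y /=.
      by rewrite subr0.
    transitivity (f (h + x) - (f x + 'd f x h)) => //.
    by rewrite fgh fgx.
  by near: h; exact: fo.
split; last exact: (diff_unique dfc go).
apply/diff_locallyP; rewrite (diff_unique dfc go); split=> //.
Unshelve. all: by end_near. Qed.

(** The remainder of the expansion of [f] is small compared with [g s - x], and [a s *: (g s - x)]
    is eventually bounded. Arbitrary weights [a] and filters [Fl] cover one-sided difference
    quotients along a curve. *)
Lemma cvg_diff_quotient (R : realType) (E F : normedModType R) (T : Type)
    (Fl : set_system T) (FF : Filter Fl) (f : E -> F) (x v : E)
    (g : T -> E) (a : T -> R) :
  differentiable f x -> g @ Fl --> x ->
  a s *: (g s - x) @[s --> Fl] --> v ->
  a s *: (f (g s) - f x) @[s --> Fl] --> 'd f x v.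
Proof.
move=> df gx agv.
have [dfc /eqaddoP fo] := (diff_locallyP _ _).1 df.
have dagv : 'd f x (a s *: (g s - x)) @[s --> Fl] --> 'd f x v.
  exact: (cvg_comp _ _ agv (dfc v)).
suff rem : a s *: (f (g s) - f x - 'd f x (g s - x)) @[s --> Fl] --> 0.
  have h := @cvgD _ _ _ _ FF _ _ _ _ rem dagv; rewrite add0r in h.
  apply: near_cvg h; apply: nearW => s.
  transitivity (a s *: (f (g s) - f x - 'd f x (g s - x)) +
    'd f x (a s *: (g s - x))) => //.
  by rewrite linearZ /= -scalerDr subrK.
apply/cvgrPdist_le => e e0.
(* [|v| + 1] is the eventual bound of [a s *: (g s - x)]; it is positive even for [v = 0], so [e]
   can be divided by it. *)
have v1 : 0 < `|v| + 1 by rewrite ltr_wpDl.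
have gx0 : g s - x @[s --> Fl] --> (0 : E).
  by rewrite -(subrr x); apply: cvgB => //; exact: cvg_cst.
have agv1 : \forall s \near Fl, `|a s *: (g s - x)| <= `|v| + 1.
  by apply: cvgr_norm_le agv _ _ => //; rewrite ltrDl.
have ev : 0 < e / (`|v| + 1) by rewrite divr_gt0.
near=> s; rewrite sub0r normrN normrZ.
have : `|f (g s) - f x - 'd f x (g s - x)| <= e / (`|v| + 1) * `|g s - x|.
  near: s; have := gx0 _ (fo _ ev); rewrite /nbhs /=.
  apply: filterS => s /=.
  rewrite [X in `|X| <= _](_ : _ =
    f (g s - x + x) - (f x + 'd f x (g s - x))) //.
  by rewrite subrK opprD addrA.
move=> /(ler_wpM2l (normr_ge0 (a s))) /le_trans; apply.
rewrite mulrCA -normrZ -[leRHS](divfK (lt0r_neq0 v1)).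
rewrite ler_pM2l//; near: s; exact: agv1.
Unshelve. all: by end_near. Qed.

(* Differentiability of a map of manifolds at p. The continuity of f is not
   implied by the second clause, as [fwd] is arbitrary off its domain. *)
Definition mdiff (R : realType) (m n : nat) (M : manifoldType R m)
    (N : manifoldType R n) (f : M -> N) (p : M) : Prop :=
  {for p, continuous f} /\
  differentiable (fwd (chart_at (f p)) \o f \o bwd (chart_at p))
    (fwd (chart_at p) p).

(** * Charts and transition maps *)

Section charts.
Variables (R : realType) (m : nat) (M : manifoldType R m).

Lemma near_dom (c : chart R m M) p : dom c p -> \forall q \near p, dom c q.
Proof. by move=> cp; apply: open_nbhs_nbhs; split=> //; exact: open_dom. Qed.

Lemma bwd_cvg (c : chart R m M) p : dom c p -> bwd c x @[x --> fwd c p] --> p.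
Proof.
by move=> cp; rewrite -{2}(fwdK cp); apply: bwd_continuous; exact: fwd_cod.
Qed.

Lemma diff_transition (c d : chart R m M) p : atlas c -> atlas d ->
  dom c p -> dom d p -> differentiable (fwd d \o bwd c) (fwd c p).
Proof.
move=> ac ad cp dp; have /(_ 1%N)[+ _] := atlas_smooth _ _ ac ad; apply.
by split; [exact: fwd_cod|rewrite /= fwdK].
Qed.

(** Chain rule for two mutually inverse transition maps: their composite is the identity near
    [fwd c p], though not everywhere. *)
Lemma diff_cancel_transition (c d : chart R m M) p u : atlas c -> atlas d ->
  dom c p -> dom d p ->
  'd (fwd c \o bwd d) (fwd d p) ('d (fwd d \o bwd c) (fwd c p) u) = u.
Proof.
move=> ac ad cp dp.
have dcd := diff_transition ac ad cp dp.
have ddc := diff_transition ad ac dp cp.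
have E : (fwd d \o bwd c) (fwd c p) = fwd d p by rewrite /= fwdK.
have := @diff_comp _ _ _ _ (fwd d \o bwd c) (fwd c \o bwd d) (fwd c p) dcd.
rewrite E => /(_ ddc) /(congr1 (fun h => h u)) /= <-.
have did : differentiable (@id 'rV[R]_m) (fwd c p) by exact: ex_diff.
have [|_ ->] := @near_eq_diff R _ _ id
  ((fwd c \o bwd d) \o (fwd d \o bwd c)) (fwd c p) _ did.
  have /(_ _ (near_dom dp)) : bwd c x @[x --> fwd c p] --> p by exact: bwd_cvg.
  have : \forall x \near fwd c p, cod c x.
    by apply: open_nbhs_nbhs; split; [exact: open_cod|exact: fwd_cod].
  by apply: filterS2 => x cx /= dx; rewrite fwdK// bwdK.
by rewrite diff_val.
Qed.

Lemma coord_inK (c : chart R m M) p (v : tangent p) : atlas c -> dom c p ->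
  of_coord c (fwd c p) (coord_in c p v) = v :> 'rV[R]_m.
Proof.
move=> ac cp; rewrite /of_coord /coord_in fwdK//.
by apply: diff_cancel_transition => //;
  [exact: chart_at_atlas|exact: chart_at_dom].
Qed.

End charts.

(** * Chain rule for maps and curves in manifolds *)

Section mdiff_theory.
Variables (R : realType) (m n q : nat).
Variables (M : manifoldType R m) (N : manifoldType R n) (Q : manifoldType R q).

(** The chart at [f p] cancels from the composite only where [f] stays in its domain; continuity of
    [f] gives this near [p], and [near_eq_diff] transfers the chain rule for [G \o F]. *)
Lemma mdiff_comp (f : M -> N) (g : N -> Q) p : mdiff f p -> mdiff g (f p) ->
  mdiff (g \o f) p /\
  forall v, tdiff (g \o f) p v = tdiff g (f p) (tdiff f p v).
Proof.
move=> [cf df] [cg dg].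
set k := chart_at p; set k' := chart_at (f p); set k'' := chart_at (g (f p)).
pose F := fwd k' \o f \o bwd k; pose G := fwd k'' \o g \o bwd k'.
have FE : F (fwd k p) = fwd k' (f p).
  by rewrite /F /= fwdK//; exact: chart_at_dom.
have dG : differentiable G (F (fwd k p)) by rewrite FE.
have [dGF eGF] : differentiable (fwd k'' \o (g \o f) \o bwd k) (fwd k p) /\
    'd (fwd k'' \o (g \o f) \o bwd k) (fwd k p) =
    'd (G \o F) (fwd k p) :> ('rV[R]_m -> 'rV[R]_q).
  apply: near_eq_diff; last exact: differentiable_comp.
  have : \forall x \near fwd k p, dom k' (f (bwd k x)).
    have fk : f (bwd k x) @[x --> fwd k p] --> f p.
      exact: (cvg_comp _ _ (bwd_cvg (chart_at_dom p)) cf).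
    exact: fk _ (near_dom (chart_at_dom (f p))).
  by apply: filterS => x /= dx; rewrite /G /F /= fwdK.
split.
  by split; [exact: (@continuous_comp _ _ _ f g)|exact: dGF].
move=> v; rewrite /tdiff -/k -/k' -/k'' -FE.
by rewrite [LHS](congr1 (fun h => h v) eGF) diff_comp.
Qed.

Lemma has_velocity_comp (f : M -> N) (D : set R) (c : R -> M) t v :
  mdiff f (c t) -> has_velocity D c t v ->
  has_velocity D (f \o c) t (tdiff f (c t) v).
Proof.
move=> [cf df] [cc dc]; split; first exact: (cvg_comp _ _ cc cf).
set k := chart_at (c t); set k' := chart_at (f (c t)).
have sub : within (D `\ t) (nbhs t) `=>` within D (nbhs t).
  by apply: within_subset => s [].
have cc' : c @ within (D `\ t) (nbhs t) --> c t by move=> A /cc /sub.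
have fc' : fwd k (c s) @[s --> within (D `\ t) (nbhs t)] --> fwd k (c t).
  by apply: (cvg_comp _ _ cc'); apply: fwd_continuous; exact: chart_at_dom.
apply: near_cvg (cvg_diff_quotient _ df fc' dc).
have : \forall s \near within (D `\ t) (nbhs t), dom k (c s).
  by apply: cc'; apply: near_dom; exact: chart_at_dom.
apply: filterS => s /= ks; rewrite /= !fwdK//; exact: chart_at_dom.
Qed.

End mdiff_theory.

Lemma smooth_map_mdiff (R : realType) (m n : nat) (M : manifoldType R m)
    (N : manifoldType R n) (f : M -> N) p :
  smooth_map_on [set: M] f -> mdiff f p.
Proof.
set c := chart_at p => /(_ c (chart_at_atlas p))[fc fs].
have cp : dom c p by exact: chart_at_dom.
have Ucp : (cod c `&` bwd c @^-1` setT) (fwd c p).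
  by split=> //; exact: fwd_cod.
split.
  have : f (bwd c (fwd c q)) @[q --> p] --> f p.
    rewrite -{2}(fwdK cp); exact: (cvg_comp _ _ (fwd_continuous cp) (fc _ Ucp)).
  apply: near_cvg; apply: filterS (near_dom cp) => q cq.
  by rewrite fwdK.
have [+ _] := fs _ (chart_at_atlas (f p)) 1%N; apply; split=> //=.
by rewrite fwdK//; exact: chart_at_dom.
Qed.

(** * Partial maps of smooth maps of two variables *)

Section smooth_map2.
Variables (R : realType) (m n q : nat).
Variables (M : manifoldType R m) (N : manifoldType R n) (Q : manifoldType R q).
Variable f : M -> N -> Q.
Hypothesis fs : smooth_map2_on [set: M] [set: N] f.

Lemma smooth_map2_continuous x y :
  {for x, continuous (f ^~ y)} /\ {for y, continuous (f x)}.
Proof.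
set c := chart_at x; set d := chart_at y.
have cx : dom c x by exact: chart_at_dom.
have dy : dom d y by exact: chart_at_dom.
have [+ _] := fs (chart_at_atlas x) (chart_at_atlas y).
rewrite -/c -/d => /(_ (fwd c x, fwd d y)) fc.
have {}fc : f (bwd c z.1) (bwd d z.2) @[z --> (fwd c x, fwd d y)] --> f x y.
  rewrite -{2}(fwdK cx) -{2}(fwdK dy).
  by apply: fc; do 2 split => //; exact: fwd_cod.
split.
- have : f (bwd c (fwd c x')) (bwd d (fwd d y)) @[x' --> x] --> f x y.
    have pc : (fwd c x', fwd d y) @[x' --> x] --> (fwd c x, fwd d y).
      exact: (cvg_pair (fwd_continuous cx) (cvg_cst _)).
    exact: (cvg_comp _ _ pc fc).
  apply: near_cvg; apply: filterS (near_dom cx) => x' cx'.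
  by rewrite !fwdK.
- have : f (bwd c (fwd c x)) (bwd d (fwd d y')) @[y' --> y] --> f x y.
    have pc : (fwd c x, fwd d y') @[y' --> y] --> (fwd c x, fwd d y).
      exact: (cvg_pair (cvg_cst _) (fwd_continuous dy)).
    exact: (cvg_comp _ _ pc fc).
  apply: near_cvg; apply: filterS (near_dom dy) => y' dy'.
  by rewrite !fwdK.
Qed.

(** Each partial map is the joint coordinate expression composed with an affine slice. The charts
    are arbitrary because the study of one-parameter subgroups reads values in the chart at 1 at
    points other than 1. *)
Lemma smooth_map2_diff (c : chart R m M) (d : chart R n N) (e : chart R q Q)
    x y : atlas c -> atlas d -> atlas e -> dom c x -> dom d y ->
  dom e (f x y) ->
  differentiable (fwd e \o f^~ y \o bwd c) (fwd c x) /\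
  differentiable (fwd e \o f x \o bwd d) (fwd d y).
Proof.
move=> ac ad ae cx dy efxy.
have [_ /(_ e ae 1%N)[/(_ (fwd c x, fwd d y)) fd _]] := fs ac ad.
have {}fd : differentiable (fwd e \o
    (fun z : 'rV[R]_m * 'rV[R]_n => f (bwd c z.1) (bwd d z.2)))
    (fwd c x, fwd d y).
  apply: fd; split; first by do 2 split => //; exact: fwd_cod.
  by rewrite /= !fwdK.
split.
- have -> : fwd e \o f^~ y \o bwd c = (fwd e \o
      (fun z : 'rV[R]_m * 'rV[R]_n => f (bwd c z.1) (bwd d z.2)))
      \o (fun x' => (x', fwd d y)).
    by apply/funext => x' /=; rewrite (fwdK dy).
  apply: differentiable_comp fd.
  by apply: differentiable_pair; [exact: ex_diff|exact: differentiable_cst].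
- have -> : fwd e \o f x \o bwd d = (fwd e \o
      (fun z : 'rV[R]_m * 'rV[R]_n => f (bwd c z.1) (bwd d z.2)))
      \o (fun y' => (fwd c x, y')).
    by apply/funext => y' /=; rewrite (fwdK cx).
  apply: differentiable_comp fd.
  by apply: differentiable_pair; [exact: differentiable_cst|exact: ex_diff].
Qed.

Lemma smooth_map2_mdiff x y : mdiff (f ^~ y) x /\ mdiff (f x) y.
Proof.
have [c1 c2] := smooth_map2_continuous x y.
have [d1 d2] := smooth_map2_diff (chart_at_atlas x) (chart_at_atlas y)
  (chart_at_atlas (f x y)) (chart_at_dom x) (chart_at_dom y)
  (chart_at_dom (f x y)).
by split; split.
Qed.

End smooth_map2.

(** * Velocities of curves *)

Section velocity_theory.
Variables (R : realType) (m : nat) (M : manifoldType R m).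

Lemma velocity_eq (D : set R) (c : R -> M) t v :
  ProperFilter (within (D `\ t) (nbhs t)) -> has_velocity D c t v ->
  velocity D c t = v.
Proof.
move=> PF hv; apply: xget_unique => // w [_ hw].
by case: hv => _ hv; exact: (cvg_unique _ hw hv).
Qed.

Lemma velocityP (D : set R) (c : R -> M) t :
  has_velocity D c t (velocity D c t) \/
  (velocity D c t = 0 :> 'rV[R]_m /\ forall v, ~ has_velocity D c t v).
Proof.
rewrite /velocity; have [[v hv]|nv] := pselect (exists v, has_velocity D c t v).
  by left; apply: xgetI hv.
have {}nv v : ~ has_velocity D c t v by move=> hv; apply: nv; exists v.
by right; split=> //; exact: xgetPN.
Qed.

Lemma has_velocity_cst (D : set R) (p : M) t :
  has_velocity D (fun=> p) t (0 : 'rV[R]_m).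
Proof.
split; first exact: cvg_cst.
have /= : (cst (0 : 'rV[R]_m)) @ within (D `\ t) (nbhs t) --> (0 : 'rV[R]_m).
  exact: cvg_cst.
by apply: near_cvg; apply: nearW => s; rewrite subrr scaler0.
Qed.

End velocity_theory.

(** Every ball around [t] contains another point of the segment, to the right if [t < b] and to the
    left if [t = b]. This makes velocities unique, also at the endpoints. *)
Lemma within_itv_proper (R : realType) (a b t : R) : a < b -> t \in `[a, b] ->
  ProperFilter (within (`[a, b] `\ t) (nbhs t)).
Proof.
move=> ab; rewrite in_itv /= => /andP[at_ tb].
apply: Build_ProperFilter_ex => P.
rewrite /within /= => /nbhs_ballP[e /= e0 eP].
have [tb'|bt] := ltP t b.
- exists (Num.min (t + e / 2) b); apply: eP.
    rewrite /ball /=; case: (ltP (t + e / 2) b) => h; rewrite ltr_distl; lra.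
  split.
    rewrite /= in_itv /=; case: (ltP (t + e / 2) b) => h; lra.
  by move=> /= E; case: (ltP (t + e / 2) b) E => h; lra.
- exists (Num.max (t - e / 2) a); apply: eP.
    rewrite /ball /=; case: (ltP (t - e / 2) a) => h; rewrite ltr_distl; lra.
  split.
    rewrite /= in_itv /=; case: (ltP (t - e / 2) a) => h; lra.
  by move=> /= E; case: (ltP (t - e / 2) a) E => h; lra.
Qed.

Lemma within_setTD1 (T : topologicalType) (x : T) :
  within (setT `\ x) (nbhs x) = x^'.
Proof.
rewrite (_ : setT `\ x = [set y | y != x])//.
by apply/seteqP; split => y /= => [[_ /eqP]|/eqP].
Qed.

Lemma tdiff0 (R : realType) (m n : nat) (M : manifoldType R m)
    (N : manifoldType R n) (f : M -> N) p :
  tdiff f p (0 : 'rV[R]_m) = 0 :> 'rV[R]_n.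
Proof. exact: linear0. Qed.

(** The left inverse [g] serves where [c] has no velocity: a velocity of [f \o c] would be mapped by
    [g] to one of [c], so both sides are then the default 0. *)
Lemma velocity_comp (R : realType) (m n : nat) (M : manifoldType R m)
    (N : manifoldType R n) (f : M -> N) (g : N -> M) (D : set R) (c : R -> M)
    t :
  cancel f g -> mdiff f (c t) -> mdiff g (f (c t)) ->
  ProperFilter (within (D `\ t) (nbhs t)) ->
  velocity D (f \o c) t = tdiff f (c t) (velocity D c t).
Proof.
move=> fK df dg PF; have [hv|[-> nv]] := velocityP D c t.
  by apply: velocity_eq; exact: has_velocity_comp.
rewrite tdiff0; have [hv|[-> //]] := velocityP D (f \o c) t.
have [v hv'] : exists v : 'rV[R]_m, has_velocity D (g \o (f \o c)) t v.
  by eexists; exact: (has_velocity_comp dg hv).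
have E : g \o (f \o c) = c by apply/funext => s /=; rewrite fK.
by rewrite E in hv'; case: (nv v).
Qed.

(** * Differentials at the identity and the crossed module *)

Lemma morph_group1 (G H : groupType) (f : G -> H) :
  {morph f : x y / (x * y)%g} -> f 1%g = 1%g.
Proof.
by move=> fM; apply: (@mulgI _ (f 1%g)); rewrite -fM !mulg1.
Qed.

Lemma lie_diff_comp (R : realType) (m n q : nat) (G : lieGroupType R m)
    (K : lieGroupType R n) (L : lieGroupType R q) (f : G -> K) (g : K -> L)
    (X : lie_alg G) :
  f 1%g = 1%g -> mdiff f 1%g -> mdiff g 1%g ->
  lie_diff (g \o f) X = lie_diff g (lie_diff f X).
Proof.
move=> f1 df dg; rewrite /lie_diff.
have dg' : mdiff g (f 1%g) by rewrite f1.
have [_ ->] := mdiff_comp df dg'.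
by rewrite f1.
Qed.

Lemma mdiff_conj (R : realType) (n : nat) (G : lieGroupType R n) (g : G) h :
  mdiff (fun h : G => (g * h * g^-1)%g) h.
Proof.
have [_ d1] := smooth_map2_mdiff (@mulg_smooth R n G) g h.
have [d2 _] := smooth_map2_mdiff (@mulg_smooth R n G) (g * h)%g (g^-1)%g.
by have [] := mdiff_comp d1 d2.
Qed.

(** Differentiate at 1 the axiom [tau_alpha], read as an equality between [tau \o alpha g] and
    conjugation by [g] after [tau]. *)
Lemma lie_diff_tau_alpha (R : realType) (m n : nat) (G : lieGroupType R m)
    (H : lieGroupType R n) (alpha : G -> H -> H) (tau : H -> G) g
    (X : lie_alg H) :
  lie_crossed_module alpha tau ->
  lie_diff tau (lie_diff (alpha g) X) = Ad g (lie_diff tau X).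
Proof.
move=> cm.
have tau1 : tau 1%g = 1%g by apply: morph_group1; exact: tauM cm.
have alpha1 : alpha g 1%g = 1%g.
  by apply: morph_group1; have [] := alpha_aut cm g.
have dtau : mdiff tau 1%g by apply: smooth_map_mdiff; exact: tau_smooth cm.
have [_ dalpha] := smooth_map2_mdiff (alpha_smooth cm) g 1%g.
rewrite /Ad -(lie_diff_comp _ alpha1 dalpha dtau).
rewrite -(lie_diff_comp _ tau1 dtau (mdiff_conj _ _)).
have -> : tau \o alpha g = (fun h => g * h * g^-1)%g \o tau.
  by apply/funext => h; rewrite [LHS](tau_alpha cm).
reflexivity.
Qed.

(** * The exponential of 0 *)

Section exp0.
Variables (R : realType) (n : nat) (G : lieGroupType R n).

(* The derivative of c at r is the image of its derivative at 0 under right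
   translation by c r. *)
Lemma one_parameter_subgroup0_derive (c : R -> G) (r : R) (j : 'I_n) :
  one_parameter_subgroup (0 : 'rV[R]_n) c -> dom (chart_at (1%g : G)) (c r) ->
  is_derive r 1 (fun s => fwd (chart_at (1%g : G)) (c s) 0 j : R^o) 0.
Proof.
move=> [cM cs cv]; set d := chart_at _ => dcr.
have c0 : c 0 = 1%g.
  by apply: (@mulgI _ (c 0)); rewrite -cM addr0 mulg1.
have d1 : dom d 1%g by exact: chart_at_dom.
have ccont s : c @ s --> c s by case: cs => /(_ s I).
case: cv => _; rewrite c0 -/d => cv.
have hc : fwd d (c s) @[s --> within (setT `\ 0) (nbhs (0 : R))] --> fwd d 1%g.
  have := ccont 0; rewrite c0 => c01.
  have := cvg_comp _ _ c01 (fwd_continuous d1).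
  exact: cvg_within_filter.
have dcr1 : dom d (1 * c r)%g by rewrite mul1g.
(* The product is read in the chart at 1 even near [c r], so that one coordinate function is
   differentiated at every [r]. *)
have [dF _] := smooth_map2_diff (@mulg_smooth R n G)
  (chart_at_atlas (1%g : G)) (chart_at_atlas (c r)) (chart_at_atlas (1%g : G))
  d1 (chart_at_dom (c r)) dcr1.
have FF : Filter (within (setT `\ (0 : R)) (nbhs (0 : R))).
  exact: within_filter.
have q0 := cvg_diff_quotient FF dF hc cv.
rewrite (linear0 ('d _ (fwd d 1%g))) /= -/d in q0.
(* As [c s * c r = c (s + r)], the quotient at 0 of the translated curve is the quotient of [c] at
   [r]. *)
have {}q0 : s^-1 *: (fwd d (c (s + r)) - fwd d (c r))
    @[s --> (0 : R)^'] --> (0 : 'rV[R]_n).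
  rewrite -within_setTD1; apply: near_cvg q0.
  have : \forall s \near within (setT `\ (0 : R)) (nbhs (0 : R)), dom d (c s).
    have := ccont 0; rewrite c0 => /(_ _ (near_dom d1)).
    exact: (@cvg_within _ (nbhs (0 : R))).
  by apply: filterS => s ds; rewrite !fwdK// mul1g -cM subr0.
have qj : s^-1 *: (fwd d (c (s *: 1 + r)) 0 j - fwd d (c r) 0 j : R^o)
    @[s --> (0 : R)^'] --> (0 : R^o).
  have := cvg_comp _ _ q0 (@coord_continuous R 1 n 0 j 0); rewrite mxE.
  by apply: near_cvg; apply: nearW => s /=; rewrite !mxE [s *: 1]mulr1.
split; first by apply/cvg_ex; exists 0.
exact: cvg_lim qj.
Qed.

(** As long as [c] stays in the chart at 1 its coordinates have derivative 0, so [c] is 1 at small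
    positive times; the homomorphism property carries this to time 1. *)
Lemma one_parameter_subgroup0 (c : R -> G) :
  one_parameter_subgroup (0 : 'rV[R]_n) c -> c 1 = 1%g.
Proof.
move=> opc; have [cM cs _] := opc.
set d := chart_at (1%g : G).
have c0 : c 0 = 1%g.
  by apply: (@mulgI _ (c 0)); rewrite -cM addr0 mulg1.
have d1 : dom d 1%g by exact: chart_at_dom.
have ccont s : c @ s --> c s by case: cs => /(_ s I).
have : \forall s \near (0 : R), dom d (c s).
  by have := ccont 0; rewrite c0 => /(_ _ (near_dom d1)).
move=> /nbhs_ballP[e /= e0 de].
have dc x : 0 <= x < e -> dom d (c x).
  by move=> /andP[x0 xe]; apply: de; rewrite /ball /= sub0r normrN ger0_norm.
have c_small s : 0 < s < e -> c s = 1%g.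
  move=> /andP[s0 se].
  suff : fwd d (c s) = fwd d (c 0).
    move=> /(congr1 (bwd d)); rewrite !fwdK ?c0//.
    by apply: dc; rewrite (ltW s0).
  apply/rowP => j; apply/subr0_eq.
  pose f := fun s : R => fwd d (c s) 0 j : R^o.
  have der x : x \in `[0, s] -> is_derive x 1 f 0.
    rewrite in_itv /= => /andP[x0 xs].
    apply: one_parameter_subgroup0_derive => //.
    by apply: dc; rewrite x0 (le_lt_trans xs).
  have fcont : {within `[0, s], continuous f}.
    apply: continuous_in_subspaceT => x; rewrite inE => /der dx.
    by apply/differentiable_continuous/derivable1_diffP.
  have der' x : x \in `]0, s[ -> is_derive x 1 f 0.
    by move=> xs; apply: der; exact: subset_itv_oo_cc.
  have [y _ fs0] := MVT s0 der' fcont.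
  by rewrite mul0r in fs0; exact: fs0.
have cn s k : c s = 1%g -> c (k%:R * s) = 1%g.
  move=> cs1; elim: k => [|k IHk]; first by rewrite mul0r.
  by rewrite -addn1 natrD mulrDl mul1r cM IHk cs1 mulg1.
(* For large [k] the time [1 / (k + 1)] is below [e], and 1 is [k + 1] times it. *)
have [k /= ke] := filter_ex (near_infty_natSinv_lt (PosNum e0)).
rewrite -(@divff _ k.+1%:R) ?pnatr_eq0//; apply: cn; apply: c_small.
by rewrite ke invr_gt0 ltr0n.
Qed.

(** Either [xget] returns its default 1, or it returns the value at 1 of a one-parameter subgroup
    with velocity 0, which is 1 as well. *)
Lemma lie_exp0 : lie_exp ((0 : 'rV[R]_n) : lie_alg G) = 1%g.
Proof.
rewrite /lie_exp; case: xgetP => // g _ [c /one_parameter_subgroup0 c1 <-].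
exact: c1.
Qed.

End exp0.

(** * Vertical vectors and right translations in the bundle *)

Section bundle.
Variables (R : realType) (nG nP nM : nat) (G : lieGroupType R nG).
Variables (P : manifoldType R nP) (M : manifoldType R nM).
Variables (proj : P -> M) (act : P -> G -> P).
Hypothesis hP : principal_bundle proj act.

(** [proj] is constant along [p exp(uY)], so it maps a velocity of this curve to that of a constant
    curve; if there is no velocity, the default is 0. *)
Lemma tdiff_proj_fundamental (Y : lie_alg G) (p : P) :
  tdiff proj p (fundamental act Y p) = 0 :> 'rV[R]_nM.
Proof.
rewrite /fundamental; set c := fun u : R => _.
have c0 : c 0 = p by rewrite /c scale0r lie_exp0 (act1 hP).
have [|[-> _]] := velocityP setT c 0; last exact: tdiff0.
move: (velocity setT c 0 : 'rV[R]_nP) => v hv.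
have dproj : mdiff proj (c 0) by apply: smooth_map_mdiff; exact: proj_smooth hP.
have := has_velocity_comp dproj hv.
have -> : proj \o c = fun=> proj p.
  by apply/funext => u; rewrite /= /c (proj_act hP).
have PF : ProperFilter (within (setT `\ (0 : R)) (nbhs (0 : R))).
  rewrite within_setTD1; exact: Proper_dnbhs_numFieldType.
move=> /(velocity_eq PF); rewrite c0 => <-.
exact: (velocity_eq PF (has_velocity_cst _ _ _)).
Qed.

Lemma velocity_act (a b : R) (c : R -> P) (t : R) (g : G) :
  a < b -> t \in `[a, b] ->
  velocity `[a, b] (fun s => act (c s) g) t =
  act_tangent act (c t) (velocity `[a, b] c t) g.
Proof.
move=> ab tab; have PF := within_itv_proper ab tab.
have dact p k := (smooth_map2_mdiff (act_smooth hP) p k).1.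
have actK : cancel (act ^~ g) (act ^~ g^-1%g).
  by move=> p; rewrite -(actM hP) mulgV (act1 hP).
exact: (velocity_comp actK (dact _ _) (dact _ _) PF).
Qed.

End bundle.

(** * Integrability of piecewise continuous functions *)

(** Replacing [B] by [B] minus [A] makes the union disjoint, so the integrals of the absolute value
    add up to a finite number. *)
Lemma integrable_setU d (T : measurableType d) (R : realType)
    (mu : {measure set T -> \bar R}) (A B : set T) (f : T -> \bar R) :
  measurable A -> measurable B ->
  mu.-integrable A f -> mu.-integrable B f -> mu.-integrable (A `|` B) f.
Proof.
move=> mA mB iA iB.
have mBA : measurable (B `\` A) by exact: measurableD.
have /integrableP[mfA fA] := iA.
have /integrableP[mfBA fBA] : mu.-integrable (B `\` A) f.
  by apply: integrableS iB => //; exact: subDsetl.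
have mfU : measurable_fun (A `|` (B `\` A)) f by exact/measurable_funU.
rewrite (_ : A `|` B = A `|` (B `\` A)); last by rewrite setUDr setDv setD0.
 apply/integrableP; split => //.
rewrite ge0_integral_setU//=.
- exact: lte_add_pinfty.
- exact: measurableT_comp.
- by apply/disj_setPS => x [Ax []].
Qed.

Section integration.
Variable R : realType.
Notation mu := (@lebesgue_measure R).
Implicit Types (f g : R -> R) (a b : R).

Lemma integrable_set1 (f : R -> \bar R) a : mu.-integrable [set a] f.
Proof.
apply/integrableP; split; first exact: measurable_fun_set1.
by rewrite integral_set1.
Qed.

(** Single points are null sets, so the values of [f] at [a] and [b] are free. For a velocity they
    may be those of a corner or the default 0. *)
Lemma integrable_itv_interior f g a b :
  {within `[a, b], continuous g} -> (forall t, t \in `]a, b[ -> f t = g t) ->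
  mu.-integrable `[a, b] (EFin \o f).
Proof.
move=> cg fg.
have ig : mu.-integrable `[a, b] (EFin \o g).
  by apply: continuous_compact_integrable => //; exact: segment_compact.
have io : mu.-integrable `]a, b[ (EFin \o g).
  by apply: integrableS ig => //; exact: subset_itv_oo_cc.
have {}io : mu.-integrable `]a, b[ (EFin \o f).
  by apply: eq_integrable io => // t; rewrite inE => /fg /= ->.
have iU : mu.-integrable (([set a] `|` `]a, b[) `|` [set b]) (EFin \o f).
  apply: integrable_setU => //; first exact: measurableU.
    by apply: integrable_setU => //; exact: integrable_set1.
  exact: integrable_set1.
apply: integrableS iU => //.
  by apply: measurableU => //; exact: measurableU.
move=> t /=; rewrite !in_itv /= => /andP[].
rewrite le_eqVlt => /predU1P[<-|at_]; first by left; left.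
by rewrite le_eqVlt => /predU1P[->|tb]; [right|left; right; rewrite at_ tb].
Qed.

Lemma path_lt_last a (s : seq R) : path <%R a s -> a <= last a s.
Proof.
by elim: s a => //= y s IHs a /andP[ay /IHs]; exact: le_trans (ltW ay).
Qed.

(** Induction on the breakpoints, gluing the first piece to the rest. Each piece comes with its
    nondegeneracy and its inclusion in the whole segment, ready for use when its integrability is
    shown. *)
Lemma integrable_path (f : R -> \bar R) a (s : seq R) : path <%R a s ->
  (forall i, (i < size s)%N -> nth a (a :: s) i < nth a s i ->
    `[nth a (a :: s) i, nth a s i] `<=` `[a, last a s] ->
    mu.-integrable `[nth a (a :: s) i, nth a s i] f) ->
  mu.-integrable `[a, last a s] f.
Proof.
elim: s a => [|y s IHs] a /=.
  by move=> _ _; rewrite set_itv1; exact: integrable_set1.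
move=> /andP[ay ys] H; have yl := path_lt_last ys.
suff iU : mu.-integrable (`[a, y] `|` `[y, last y s]) f.
  apply: integrableS iU => //; first exact: measurableU.
  move=> t /=; rewrite !in_itv /= => /andP[at_ tl].
  by have [ty|yt] := leP t y; [left; rewrite at_|right; rewrite (ltW yt)].
apply: integrable_setU => //.
  apply: (H 0%N) => //= t /=; rewrite !in_itv /= => /andP[-> ty].
  exact: le_trans ty yl.
(* Piece [i] of the tail is piece [i.+1] of the whole list, up to the default value of [nth]. *)
apply: IHs => // i si; have := H i.+1 si.
rewrite /= (set_nth_default y a si).
have -> : nth a (y :: s) i = nth y (y :: s) i.
  by apply: set_nth_default; rewrite ltnW.
move=> {}H lt_i sub; apply: H => //.
apply: (subset_trans sub) => t /=; rewrite !in_itv /= => /andP[yt ->].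
by rewrite (le_trans (ltW ay) yt).
Qed.

Lemma Rintegral_sum (I : Type) (s : seq I) (D : set R) (F : I -> R -> R) :
  measurable D -> (forall i, mu.-integrable D (EFin \o F i)) ->
  \int[mu]_(t in D) (\sum_(i <- s) F i t) =
  \sum_(i <- s) \int[mu]_(t in D) F i t.
Proof.
move=> mD iF; elim: s => [|i s IHs].
  rewrite big_nil; under eq_Rintegral do rewrite big_nil.
  by rewrite Rintegral_cst// mul0r.
rewrite big_cons -IHs -RintegralD//.
  by apply: eq_Rintegral => t _; rewrite big_cons.
rewrite (_ : _ \o _ = fun t => (\sum_(i <- s) (EFin \o F i) t)%E).
  exact: integrable_sum.
by apply/funext => t /=; rewrite sumEFin.
Qed.

End integration.

(** * Integrals with values in a Lie algebra *)

Lemma eq_lie_integral (R : realType) (n : nat) (H : lieGroupType R n) (a b : R)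
    (f g : R -> lie_alg H) :
  (forall t, t \in `[a, b] -> f t = g t) ->
  lie_integral a b f = lie_integral a b g.
Proof.
move=> fg; apply/rowP => j; rewrite !mxE; apply: eq_Rintegral => t.
by rewrite inE => /fg ->.
Qed.

Lemma lie_integral_lie_diff (R : realType) (m n : nat) (H : lieGroupType R m)
    (K : lieGroupType R n) (h : H -> K) (a b : R) (f : R -> lie_alg H) :
  (forall i, lebesgue_measure.-integrable `[a, b]
    (EFin \o (fun t => (f t : 'rV[R]_m) 0 i))) ->
  lie_integral a b (fun t => lie_diff h (f t)) =
  lie_diff h (lie_integral a b f).
Proof.
move=> fi; rewrite /lie_diff /tdiff.
set L := 'd _ _.
(* In matrix form, each coordinate of [L (f t)] is a finite combination of the coordinates of [f t]
   with constant coefficients, and these leave the integral. *)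
have LE u j : L u 0 j = \sum_(i < m) u 0 i * L 'e_i 0 j.
  rewrite [in LHS](row_sum_delta u) linear_sum summxE.
  by apply: eq_bigr => i _; rewrite linearZ mxE.
apply/rowP => j; rewrite mxE LE.
under eq_Rintegral do rewrite LE.
rewrite Rintegral_sum//.
  by apply: eq_bigr => i _; rewrite RintegralZr// mxE.
by move=> i; exact: integrableZr (fi i).
Qed.

(** * The 2-form along a path *)

Lemma linear_row (R : realType) (m n : nat) (f : 'rV[R]_m -> 'rV[R]_n)
    (u : 'rV[R]_m) :
  linear f -> f u = \sum_(i < m) u 0 i *: f 'e_i.
Proof.
move=> lf.
have f0 : f 0 = 0.
  by have := lf (-1) 0 0; rewrite scaler0 addr0 scaleN1r addNr.
rewrite {1}(row_sum_delta u); elim/big_rec2 : _ => [//|i y x _ <-].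
exact: lf.
Qed.

Section two_form_theory.
Variables (R : realType) (nP nH : nat) (P : manifoldType R nP).
Variables (H : lieGroupType R nH).
Variable B : forall p : P, tangent p -> tangent p -> lie_alg H.
Hypothesis hB : two_form B.

(** Expansion in the coordinate frame of [k]. It separates the coordinates of [u] and [w], to which
    [continuous_field] refers, from the coefficients, to which [two_form_smooth] refers. *)
Lemma two_form_coord (k : chart R nP P) (p : P) (u w : tangent p) :
  atlas k -> dom k p ->
  B u w = \sum_(i < nP) \sum_(l < nP)
    (coord_in k p u : 'rV[R]_nP) 0 i *: ((coord_in k p w : 'rV[R]_nP) 0 l *:
      (B (of_coord k (fwd k p) 'e_i) (of_coord k (fwd k p) 'e_l)
       : 'rV[R]_nH)) :> 'rV[R]_nH.
Proof.
move=> ak kp.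
(* Taking plain coordinate rows as arguments lets [bwd k (fwd k p)] be rewritten to [p] while the
   vectors stay fixed. *)
pose b (q : P) (u w : 'rV[R]_nP) := @B q u w : 'rV[R]_nH.
pose C := 'd (fwd (chart_at p) \o bwd k) (fwd k p).
have ocE z : of_coord k (fwd k p) z = C z :> 'rV[R]_nP.
  by rewrite /of_coord fwdK.
have -> : B u w = b p (C (coord_in k p u)) (C (coord_in k p w)) :> 'rV[R]_nH.
  by rewrite -!ocE !coord_inK.
have lC : linear C by move=> a x y; rewrite linearP.
have lb1 z : linear (fun x => b p (C x) z).
  by move=> a x y; rewrite lC; exact: (two_form_linear_l hB).
have lb2 z : linear (fun x => b p z (C x)).
  by move=> a x y; rewrite lC; exact: (two_form_linear_r hB).
rewrite (linear_row _ (lb1 _)); apply: eq_bigr => i _.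
rewrite (linear_row _ (lb2 _)) scaler_sumr; apply: eq_bigr => l _.
have -> : B (of_coord k (fwd k p) 'e_i) (of_coord k (fwd k p) 'e_l) =
    b (bwd k (fwd k p)) (C 'e_i) (C 'e_l) :> 'rV[R]_nH.
  by rewrite -!ocE.
by rewrite fwdK.
Qed.

(** Expand the vanishing value of [B] on the pair [u + w], [u + w]. This carries the vanishing on
    vertical vectors over to the second argument. *)
Lemma two_form_eq0C (p : P) (u w : tangent p) :
  B u w = (0 : 'rV[R]_nH) -> B w u = (0 : 'rV[R]_nH).
Proof.
move=> uw0; pose b (u w : 'rV[R]_nP) := @B p u w : 'rV[R]_nH.
have bDl x y z : b (x + y) z = b x z + b y z.
  by rewrite -[x in LHS]scale1r [LHS](two_form_linear_l hB) scale1r.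
have bDr x y z : b z (x + y) = b z x + b z y.
  by rewrite -[x in LHS]scale1r [LHS](two_form_linear_r hB) scale1r.
have b0 z : b z z = 0 by exact: (two_form_alternating hB).
have := b0 ((u : 'rV[R]_nP) + w).
by rewrite bDl !bDr !b0 add0r addr0 [X in X + _]uw0 add0r.
Qed.

Lemma two_form_cvg (D : set R) (c : R -> P) (v w : forall t, tangent (c t))
    t j :
  D t -> c @ within D (nbhs t) --> c t ->
  continuous_field D c v -> continuous_field D c w ->
  (B (v s) (w s) : 'rV[R]_nH) 0 j @[s --> within D (nbhs t)] -->
  (B (v t) (w t) : 'rV[R]_nH) 0 j.
Proof.
move=> Dt ct cv cw; set k := chart_at (c t).
have ak : atlas k by exact: chart_at_atlas.
have kt : dom k (c t) by exact: chart_at_dom.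
have BE s : dom k (c s) -> (B (v s) (w s) : 'rV[R]_nH) 0 j =
    \sum_(i < nP) \sum_(l < nP) coord_in k (c s) (v s) 0 i *
    (coord_in k (c s) (w s) 0 l *
     (B (of_coord k (fwd k (c s)) 'e_i) (of_coord k (fwd k (c s)) 'e_l)
       : 'rV[R]_nH) 0 j).
  move=> ks; rewrite (two_form_coord _ _ ak ks) summxE.
  by apply: eq_bigr => i _; rewrite summxE; apply: eq_bigr => l _; rewrite !mxE.
have FF : Filter (within D (nbhs t)) by exact: within_filter.
rewrite (BE _ kt).
have kc : \forall s \near within D (nbhs t), dom k (c s).
  exact: ct _ (near_dom kt).
apply: (@near_cvg _ _ _ FF _ (fun s => \sum_(i < nP) \sum_(l < nP)
    coord_in k (c s) (v s) 0 i *
    (coord_in k (c s) (w s) 0 l *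
     (B (of_coord k (fwd k (c s)) 'e_i) (of_coord k (fwd k (c s)) 'e_l)
       : 'rV[R]_nH) 0 j))).
  by apply: filterS kc => s /BE ->.
apply: cvg_big => [|i _]; first exact: add_continuous.
apply: cvg_big => [|l _]; first exact: add_continuous.
apply: cvgM.
  exact: (cvg_comp _ _ (cv _ Dt) (@coord_continuous R 1 nP 0 i _)).
apply: cvgM.
  exact: (cvg_comp _ _ (cw _ Dt) (@coord_continuous R 1 nP 0 l _)).
have fc : fwd k (c s) @[s --> within D (nbhs t)] --> fwd k (c t).
  exact: (cvg_comp _ _ ct (fwd_continuous kt)).
(* Smoothness at order 0 is continuity of the coefficient. *)
have Bc := two_form_smooth hB 'e_i 'e_l ak 0%N _ (fwd_cod kt).
have fB := cvg_comp _ _ fc Bc.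
exact: (cvg_comp _ _ fB (@coord_continuous R 1 nH 0 j _)).
Qed.

(** On the interior of each C^1 piece the velocity is the continuous field [w] of that piece, so the
    integrand agrees there with a function continuous on the closed piece. *)
Lemma two_form_integrable (t0 t1 : R) (c : R -> P)
    (v : forall t, tangent (c t)) j :
  t0 < t1 -> piecewise_C1 t0 t1 c -> continuous_field `[t0, t1] c v ->
  lebesgue_measure.-integrable `[t0, t1] (EFin \o
    (fun t => (B (velocity `[t0, t1] c t) (v t) : 'rV[R]_nH) 0 j)).
Proof.
move=> t01 [_ [s [ps lst C1]]] cv.
rewrite -{1}lst; apply: integrable_path => // i si ab; rewrite lst.
move: (C1 i si) ab; set a := nth t0 (t0 :: s) i; set b := nth t0 s i.
move=> [w [wv cw]] ab abD.
apply: (@integrable_itv_interior _ _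
  (fun t => (B (w t) (v t) : 'rV[R]_nH) 0 j)).
  apply/subspace_continuousP => t tab; apply: two_form_cvg => //.
    by case: (wv t tab).
  move=> r rab; have := cv r (abD _ rab) => h A /h.
  by apply: within_subset.
move=> t tab.
have tabc : t \in `[a, b] by exact: subset_itv_oo_cc.
have tD : t \in `[t0, t1] by exact: abD.
rewrite (_ : velocity `[t0, t1] c t = w t)//.
apply: velocity_eq; first exact: within_itv_proper.
(* Near an interior point of the piece, [[a, b]] and [[t0, t1]] both contain all points, so the
   derivative relative to one is the derivative relative to the other. *)
have near_ab : \forall r \near t, r \in `]a, b[ by exact: near_in_itvoo.
have [h1 h2] := wv t tabc.
split.
  move=> A /h1; rewrite /fmap /within /= => hA.
  apply: filterS2 near_ab hA => r rab hA _; apply: hA.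
  exact: subset_itv_oo_cc.
move=> A /h2; rewrite /fmap /within /= => hA.
apply: filterS2 near_ab hA => r rab hA [_ rt]; apply: hA; split => //.
exact: subset_itv_oo_cc.
Qed.

End two_form_theory.

(** * Equivariance of [omega] and its values on fundamental fields *)

Theorem proposition2p3 (R : realType) (nG nH nP nM : nat)
  (G : lieGroupType R nG) (H : lieGroupType R nH)
  (alpha : G -> H -> H) (tau : H -> G)
  (hGH : lie_crossed_module alpha tau)
  (P : manifoldType R nP) (M : manifoldType R nM)
  (proj : P -> M) (act : P -> G -> P) (hP : principal_bundle proj act)
  (Abar A : forall p : P, tangent p -> lie_alg G)
  (hAbar : connection_form act Abar) (hA : connection_form act A)
  (B : forall p : P, tangent p -> tangent p -> lie_alg H)
  (hB : two_form B) (hBeq : alpha_equivariant act alpha B)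
  (hBvert : vanishes_on_vertical proj B) :
  (forall (t0 t1 : R) (gamma : R -> P) (v : forall t, tangent (gamma t))
     (g : G),
     t0 < t1 -> piecewise_C1 t0 t1 gamma -> horizontal Abar t0 t1 gamma ->
     continuous_field `[t0, t1] gamma v ->
     omega tau A B t0 t1 (fun t => act (gamma t) g)
         (fun t => act_tangent act (gamma t) (v t) g)
       = Ad (g^-1)%g (omega tau A B t0 t1 gamma v)) /\
  (forall (t0 t1 : R) (gamma : R -> P) (Y : lie_alg G),
     t0 < t1 -> piecewise_C1 t0 t1 gamma -> horizontal Abar t0 t1 gamma ->
     omega tau A B t0 t1 gamma (fun t => fundamental act Y (gamma t)) = Y).
Proof.
split=> [t0 t1 gamma v g t01 C1 _ cv|t0 t1 gamma Y _ _ _]; rewrite /omega.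
- rewrite (connection_equivariant hA).
  rewrite (@eq_lie_integral _ _ _ _ _ _ (fun t => lie_diff (alpha g^-1%g)
    (B (gamma t) (velocity `[t0, t1] gamma t) (v t)))); last first.
    by move=> t tD; rewrite (velocity_act hP)// hBeq.
  rewrite lie_integral_lie_diff; last first.
    by move=> j; exact: two_form_integrable.
  rewrite (lie_diff_tau_alpha _ _ hGH).
  (* [Ad] is by definition a differential, hence additive. *)
  by rewrite [RHS]linearD.
- rewrite (connection_fundamental hA).
  rewrite (@eq_lie_integral _ _ _ _ _ _ (fun=> 0 : 'rV[R]_nH)); last first.
    (* The vertical vector is the second argument of [B], whereas [hBvert] speaks of the first. *)
    move=> t _; apply: (two_form_eq0C hB); apply: hBvert.
    exact: tdiff_proj_fundamental.
  rewrite (_ : lie_integral _ _ _ = 0 :> 'rV[R]_nH).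
    by rewrite [X in _ + X]tdiff0 addr0.
  by apply/rowP => j; rewrite !mxE Rintegral_cst// mul0r.
Qed.
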